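(* For all integers $k\ge 2$, $\ell\ge 3$ and $r\ge 2$, \[ R(P_\ell^{(k)};r)\le (k-1)\ell r . \]
   Context: A $k$-uniform hypergraph ($k$-graph) is a pair (vertex set, set of $k$-element subsets called edges). For integers $k\ge 2$ and $\ell\ge 0$, the loose path $P_\ell^{(k)}$ is the $k$-graph with vertex set $\{v_1,\dots,v_{(k-1)\ell+1}\}$ and edges $e_i=\{v_{(i-1)(k-1)+q}:1\le q\le k\}$, $i=1,\dots,\ell$; so consecutive edges share exactly one vertex and non-consecutive edges are disjoint ($P_0^{(k)}$ is a single vertex, $P_1^{(k)}$ a single edge, and $P_\ell^{(2)}$ is the graph path with $\ell$ edges). $K_n^{(k)}$ denotes the complete $k$-graph on $n$ vertices. For a $k$-graph $H$ and integer $r\ge 2$, the multicolor Ramsey number $R(H;r)$ is the minimum $n$ such that every coloring of the edges of $K_n^{(k)}$ with $r$ colors contains a monochromatic copy of $H$. *)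

(* Defs.v *)
From mathcomp Require Import all_boot.
Set Implicit Arguments. Unset Strict Implicit. Unset Printing Implicit Defensive.

Definition is_kgraph (k : nat) (V : finType) (E : {set {set V}}) : Prop :=
  forall e, e \in E -> #|e| = k.

(* Loose path P_l^(k): vertices v_1..v_{(k-1)l+1} represented (0-indexed)
   by 'I_((k-1)*l+1); edge e_i (i = 1..l) is {v_{(i-1)(k-1)+q} : 1<=q<=k},
   i.e. 0-indexed vertices j*(k-1) .. j*(k-1)+(k-1) for j = i-1 < l. *)
Definition loose_path_edge (k l j : nat) : {set 'I_((k-1)*l+1)} :=
  [set v : 'I_((k-1)*l+1) | (j * (k-1) <= v) && (v <= j * (k-1) + (k-1))].

Definition loose_path (k l : nat) : {set {set 'I_((k-1)*l+1)}} :=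
  [set loose_path_edge k l (nat_of_ord j) | j : 'I_l].

(* An r-coloring of the edges of K_n^(k) (vertex set 'I_n): a map from
   subsets of 'I_n to colors 'I_r; only its values on k-subsets matter.
   A monochromatic copy of H = (V,E) is an injective vertex map f such that
   all images of edges of H (which are k-subsets, i.e. edges of K_n^(k))
   receive the same color. *)
Definition has_mono_copy (n r : nat) (c : {set 'I_n} -> 'I_r)
  (V : finType) (E : {set {set V}}) : Prop :=
  exists (f : V -> 'I_n) (col : 'I_r),
    injective f /\ forall e, e \in E -> c (f @: e) = col.

Definition ramsey_prop (V : finType) (E : {set {set V}}) (r n : nat) : Prop :=
  forall c : {set 'I_n} -> 'I_r, has_mono_copy c E.

Definition is_ramsey_number (V : finType) (E : {set {set V}}) (r R : nat) : Prop :=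
  ramsey_prop E r R /\ forall n, ramsey_prop E r n -> R <= n.

(* Main.v *)
(* Induction on the uniformity. For graphs, the most frequent colour on l r
   vertices has more than (l - 1) l r / 2 edges, so the Erdos-Gallai theorem
   gives a monochromatic path with l edges. To pass from k to k + 1, set aside
   a set B of l r vertices and colour each k-subset e of the remaining vertices
   with a colour taken by c (b |: e) for at least l vertices b of B. The l
   edges of a monochromatic loose k-path can then be extended greedily by
   distinct vertices of B. *)
Require Import Defs.
From Stdlib Require Import Classical.
From mathcomp Require Import all_boot zify.
Set Implicit Arguments. Unset Strict Implicit. Unset Printing Implicit Defensive.

(** * Arc counts and the closing of a path into a cycle *)

Section Graph.
Variables (T : finType) (e : rel T).
Hypotheses (esym : symmetric e) (eirr : irreflexive e).

Definition arcs (A B : {set T}) := \sum_(x in A) \sum_(y in B) (e x y : nat).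

Lemma arcsC (A B : {set T}) : arcs A B = arcs B A.
Proof.
rewrite /arcs exchange_big; apply: eq_bigr => y _.
by apply: eq_bigr => x _; rewrite esym.
Qed.

Lemma arcs_splitl (A B S : {set T}) : S \subset A -> arcs A B = arcs S B + arcs (A :\: S) B.
Proof. by move=> /setIidPr sSA; rewrite /arcs (big_setID S) sSA. Qed.

(** The first two terms are the arcs lost when [S] is deleted: those leaving [S], and by symmetry
    those entering it from [A :\: S]. *)
Lemma arcs_remove (A S : {set T}) : S \subset A ->
  arcs A A = arcs S A + arcs S (A :\: S) + arcs (A :\: S) (A :\: S).
Proof.
move=> sSA; rewrite (arcs_splitl A sSA) -addnA; congr (_ + _).
by rewrite arcsC (arcs_splitl _ sSA).
Qed.

Lemma arcs_vertex x (A : {set T}) : arcs [set x] A = #|[set y in A | e x y]|.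
Proof.
rewrite /arcs big_set1 -sum1dep_card big_mkcondr.
by apply: eq_bigr => y _; case: (e x y).
Qed.

Lemma arcs_inner_le (A : {set T}) : arcs A A <= #|A| * #|A|.-1.
Proof.
rewrite /arcs -sum_nat_const; apply: leq_sum => x xA.
rewrite (bigD1 x) //= eirr (cardsD1 x) xA /= -sum1_card.
rewrite (eq_bigl (mem (A :\ x))) => [|y]; last by rewrite !inE andbC.
by apply: leq_sum => y _; case: (e x y).
Qed.

(** Pigeonhole on the [size s] steps of the path: [I] marks steps whose head is adjacent to the
    first vertex, [J] those whose tail is adjacent to the last. By irreflexivity neither end is its
    own neighbour, so every neighbour gets a step, and [I] and [J] must meet. *)
Lemma crossing_chord s x : uniq (x :: s) ->
    (forall y, e x y -> y \in x :: s) ->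
    (forall y, e (last x s) y -> y \in x :: s) ->
  size s < #|[set y | e x y]| + #|[set y | e (last x s) y]| ->
  exists i, [/\ i < size s, e x (nth x (x :: s) i.+1)
              & e (nth x (x :: s) i) (last x s)].
Proof.
move=> us nx nl lts.
pose m := size s; pose t := x :: s.
pose I := [set i : 'I_m | e x (nth x t i.+1)].
pose J := [set i : 'I_m | e (nth x t i) (last x s)].
have leI : #|[set y | e x y]| <= #|I|.
  apply: leq_trans (leq_imset_card (fun i : 'I_m => nth x t i.+1) I).
  apply/subset_leq_card/subsetP => y; rewrite inE => exy.
  have yt := nx _ exy.
  have y_lt : index y t < m.+1 by rewrite index_mem.
  have := nth_index x yt; case E : (index y t) => [|j] /= ty.
    by rewrite -ty eirr in exy.
  have jm : j < m by rewrite E in y_lt.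
  by apply/imsetP; exists (Ordinal jm); rewrite ?inE /= ty.
have leJ : #|[set y | e (last x s) y]| <= #|J|.
  apply: leq_trans (leq_imset_card (fun i : 'I_m => nth x t i) J).
  apply/subset_leq_card/subsetP => y; rewrite inE => ely.
  have yt := nl _ ely.
  have y_lt : index y t < m.+1 by rewrite index_mem.
  have ty := nth_index x yt.
  have jm : index y t < m.
    rewrite ltn_neqAle -ltnS y_lt andbT; apply: contraTneq ely => E.
    by rewrite -ty E /t nth_last /= eirr.
  by apply/imsetP; exists (Ordinal jm); rewrite ?inE /= ty // esym.
have IJ : I :&: J != set0.
  rewrite -card_gt0; have := cardsUI I J; have := max_card (I :|: J).
  rewrite card_ord -/m; move: lts; rewrite -/m; lia.
case/set0Pn: IJ => i; rewrite !inE => /andP[ei ej].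
by exists i.
Qed.

(** The cycle follows the path up to position [i], jumps to the last vertex, runs backwards to
    position [i.+1] and returns to [x]. *)
Lemma chord_cycle s x i : path e x s -> i < size s ->
  e x (nth x (x :: s) i.+1) -> e (nth x (x :: s) i) (last x s) ->
  exists2 c, cycle e c & perm_eq c (x :: s).
Proof.
move=> ps im ex el; exists (x :: take i s ++ rev (drop i s)); last first.
  by rewrite perm_cons -{3}(cat_take_drop i s) perm_cat2l perm_rev.
have lt_last : last x (take i s) = nth x (x :: s) i.
  by rewrite (last_nth x) size_take im -{2}(cat_take_drop i s) -cat_cons
             nth_cat /= size_take im ltnSn.
have := drop_nth x im; move: ps; rewrite -{1}(cat_take_drop i s) cat_path.
case/andP=> p1 p2 dE.
rewrite /= rcons_path cat_path p1 /= last_cat.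
have -> : last (last x (take i s)) (rev (drop i s)) = nth x s i.
  by rewrite dE rev_cons last_rcons.
rewrite esym ex andbT.
have lastE : last x s = last (nth x s i) (drop i.+1 s).
  by rewrite -{1}(cat_take_drop i s) last_cat dE.
move: p2; rewrite dE /= => /andP[_ p2].
rewrite -rev_path in p2.
have p3 : path e (last (nth x s i) (drop i.+1 s))
                 (rev (belast (nth x s i) (drop i.+1 s))).
  by rewrite (eq_path (e' := fun z : T => e^~ z)) // => a b; rewrite esym.
rewrite lastI rev_rcons /= lt_last -lastE el /=.
by rewrite lastE.
Qed.

(** Cutting the cycle open at [y] and starting from [z] uses every vertex of [c] and one more. *)
Lemma cycle_exit c y z : cycle e c -> uniq c -> y \in c -> z \notin c -> e y z ->
  exists x s, [/\ path e x s, uniq (x :: s), size s = size c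
                & x :: s =i z :: c].
Proof.
move=> cc uc yc zc eyz; case/rot_to: (yc) => i q cE.
exists z, (y :: q); split.
- rewrite /= esym eyz /=.
  by move: cc; rewrite -(rot_cycle i e) cE /= rcons_path => /andP[].
- by rewrite cons_uniq -cE mem_rot zc rot_uniq.
- by rewrite -cE size_rot.
- by move=> a; rewrite -cE !inE mem_rot.
Qed.

End Graph.

(** * The Erdos-Gallai theorem *)

Section ErdosGallai.
Variables (T : finType) (e : rel T).
Hypotheses (esym : symmetric e) (eirr : irreflexive e).

Definition has_path (A : {set T}) l :=
  exists x s, [/\ path e x s, uniq (x :: s), size s = l & {subset x :: s <= A}].

Lemma has_path_sub (A B : {set T}) l : A \subset B -> has_path A l -> has_path B l.
Proof.
move=> /subsetP sAB [x [s [ps us ss sA]]].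
by exists x, s; split=> // y /sA /sAB.
Qed.

(* If both ends of the path have all their neighbours on it, crossing chords
   close it into a cycle [S]; an edge leaving [S] gives a longer path. *)
Lemma path_extend (A : {set T}) l m : m < l -> has_path A m ->
    (forall x, x \in A -> l <= 2 * #|[set y in A | e x y]|) ->
  has_path A m.+1 \/
  exists S : {set T}, [/\ S \subset A, #|S| = m.+1 & forall x y,
                x \in S -> y \in A :\: S -> ~~ e x y].
Proof.
move=> lt_ml [x [s [ps us ss sA]]] mind.
have xA : x \in A by apply: sA; rewrite mem_head.
have lA : last x s \in A by apply/sA/mem_last.
case: (pickP [pred z in A | (z \notin x :: s) && e x z]) => [z /and3P[zA zs exz]|nx].
  left; exists z, (x :: s); split; rewrite /= ?ss //.
  - by rewrite esym exz.
  - by move: us; rewrite /= zs.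
  - by move=> y; rewrite inE => /orP[/eqP->|/sA].
case: (pickP [pred z in A | (z \notin x :: s) && e (last x s) z]) => [z /and3P[zA zs elz]|nl].
  left; exists x, (rcons s z); split.
  - by rewrite rcons_path ps.
  - by rewrite -rcons_cons rcons_uniq zs.
  - by rewrite size_rcons ss.
  - by move=> y; rewrite -rcons_cons mem_rcons inE => /orP[/eqP->|/sA].
(* Restricting [e] to [A] discards neighbours outside [A], about which nothing is known. *)
pose f := [rel a b | [&& a \in A, b \in A & e a b]].
have fsym : symmetric f by move=> a b; rewrite /= esym andbCA.
have firr : irreflexive f by move=> a; rewrite /= eirr !andbF.
have fdeg a : a \in A -> [set y | f a y] = [set y in A | e a y].
  by move=> aA; apply/setP=> y; rewrite !inE /= aA.
have := @crossing_chord T f fsym firr s x us.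
case=> [y /= /and3P[_ yA exy]|y /= /and3P[_ yA ely]||i [im ex el]].
- by move: (nx y); rewrite /= yA exy andbT => /negbFE.
- by move: (nl y); rewrite /= yA ely andbT => /negbFE.
- rewrite !fdeg // ss -(ltn_pmul2l (isT : 0 < 2)) mulnDr.
  by apply: leq_trans (leq_add (mind _ xA) (mind _ lA)); lia.
have pf : path f x s.
  apply: (sub_in_path (P := mem A)) ps; last by apply/allP.
  by move=> a b aA bA eab; rewrite /= aA bA.
have [c cc pc] := chord_cycle fsym pf im ex el.
have uc : uniq c by rewrite (perm_uniq pc).
case: (pickP [pred p : T * T | [&& p.1 \in c, p.2 \in A, p.2 \notin c & e p.1 p.2]]).
  move=> [y z] /= /and4P[yc zA zc eyz].
  have ce : cycle e c by apply: sub_cycle cc => a b /and3P[].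
  have [x' [s' [ps' us' ss' mem']]] := cycle_exit esym ce uc yc zc eyz.
  left; exists x', s'; split=> //.
    by rewrite ss' (perm_size pc) /= ss.
  move=> a; rewrite mem' inE => /orP[/eqP->//|ac].
  by apply: sA; rewrite -(perm_mem pc).
move=> nc; right; exists [set y in c]; split.
- by apply/subsetP=> y; rewrite inE (perm_mem pc) => /sA.
- by rewrite cardsE (card_uniqP uc) (perm_size pc) /= ss.
- move=> y z; rewrite !inE => yc /andP[zc zA].
  by move: (nc (y, z)); rewrite /= yc zc zA /= => ->.
Qed.

(* [arcs e A A] counts each edge inside [A] twice. *)
Theorem erdos_gallai l (A : {set T}) :
  0 < l -> l.-1 * #|A| < arcs e A A -> has_path A l.
Proof.
move=> l_gt0; have [n] := ubnP #|A|; elim: n A => // n IHn A ltAn dA.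
(* Deleting [S] at a cost of at most [l.-1] arcs per vertex preserves the density hypothesis, so
   induction applies. *)
have remove (S : {set T}) : S \subset A -> S != set0 ->
    arcs e S A + arcs e S (A :\: S) <= l.-1 * #|S| -> has_path A l.
  move=> sSA S0 leS; apply: (has_path_sub (subsetDl A S)).
  rewrite -card_gt0 in S0; have cA := cardsID S A.
  rewrite (setIidPr sSA) in cA.
  apply: IHn; first by lia.
  move: dA; rewrite (arcs_remove esym sSA) -cA mulnDr; lia.
(* A vertex of degree below [l / 2] can be deleted; otherwise every degree is large enough for
   [path_extend]. *)
case: (pickP [pred x in A | 2 * #|[set y in A | e x y]| < l]).
  move=> x /andP[xA dx]; apply: (remove [set x]); rewrite ?sub1set //.
    by apply/set0Pn; exists x; rewrite set11.
  rewrite !arcs_vertex cards1.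
  suff : #|[set y in A :\ x | e x y]| <= #|[set y in A | e x y]| by lia.
  by apply/subset_leq_card/subsetP=> y; rewrite !inE => /andP[/andP[_ ->]].
move=> mind.
have {}mind x : x \in A -> l <= 2 * #|[set y in A | e x y]|.
  by move=> xA; move: (mind x); rewrite /= xA /= => /negbT; rewrite -leqNgt.
suff : forall m, m <= l -> has_path A m \/ has_path A l by case/(_ l (leqnn l)).
elim=> [_|m IHm lt_ml].
  have /set0Pn[x xA] : A != set0.
    by apply: contraTneq dA => ->; rewrite /arcs big_set0.
  by left; exists x, [::]; split=> // y; rewrite inE => /eqP->.
case: (IHm (ltnW lt_ml)) => [pm|]; last by right.
case: (path_extend lt_ml pm mind) => [|[S [sSA cS cl]]]; first by left.
(* No edge joins [S] to the rest, so only the at most [m.+1 * m] inner arcs are lost, and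
   [m <= l.-1]. *)
right; apply: (remove S) => //; first by rewrite -card_gt0 cS.
have out0 : arcs e S (A :\: S) = 0.
  rewrite /arcs big1 // => x xS; rewrite big1 // => y yS.
  by rewrite (negbTE (cl x y xS yS)).
rewrite out0 addn0 arcsC // (arcs_splitl _ _ sSA) [arcs e (_ :\: _) _]arcsC //.
rewrite out0 addn0; apply: leq_trans (arcs_inner_le eirr S) _.
rewrite cS mulnC leq_mul2r /=; lia.
Qed.

End ErdosGallai.

(** * Monochromatic loose paths and the graph case *)

(* [f] lists the vertices of a loose path with [l] edges of size [K.+1] along
   the path, so that edge number [j] is [f (j * K), ..., f (j * K + K)]. *)
Definition mono_loose_path (T : finType) r (c : {set T} -> 'I_r) (A : {set T})
    K l :=
  exists (f : nat -> T) (col : 'I_r),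
    [/\ {in gtn (K * l).+1 &, injective f},
        forall v, v <= K * l -> f v \in A
      & forall j, j < l -> c [set f (j * K + q) | q : 'I_K.+1] = col].

Lemma mono_path_graph (T : finType) l r (c : {set T} -> 'I_r) (A : {set T}) :
  0 < l -> 1 < r -> l * r <= #|A| -> mono_loose_path c A 1 l.
Proof.
move=> l_gt0 r_gt1 leA.
pose e i := [rel x y : T | (x != y) && (c [set x; y] == i)].
have esym i : symmetric (e i) by move=> x y; rewrite /= eq_sym setUC.
have eirr i : irreflexive (e i) by move=> x; rewrite /= eqxx.
have total : \sum_i arcs (e i) A A = #|A| * #|A|.-1.
  rewrite /arcs exchange_big -sum_nat_const; apply: eq_bigr => x xA.
  rewrite exchange_big (bigD1 x) //= big1 ?add0n; last by move=> i _; rewrite eqxx.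
  rewrite (cardsD1 x) xA /= -sum1_card.
  rewrite [RHS](eq_bigl (fun y => (y \in A) && (y != x))); last first.
    by move=> y; rewrite !inE andbC.
  apply: eq_bigr => y /andP[_ yx].
  rewrite (bigD1 (c [set x; y])) //= eq_sym yx eqxx big1 ?addn0 // => i ne.
  by rewrite eq_sym (negbTE ne).
have [i di] : exists i, l.-1 * #|A| < arcs (e i) A A.
  apply/existsP; apply: contraTT isT; rewrite negb_exists => /forallP small.
  have : \sum_i arcs (e i) A A <= \sum_(i < r) l.-1 * #|A|.
    by apply: leq_sum => i _; rewrite leqNgt small.
  rewrite total sum_nat_const card_ord.
  (* Here [r * l.-1 <= #|A| - r], and [1 < r] makes the inequality strict; it contradicts
     [total]. *)
  have : r * l.-1 < #|A|.-1 by nia.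
  have : 0 < #|A| by nia.
  nia.
have [x [s [ps us ss sA]]] := erdos_gallai (esym i) (eirr i) l_gt0 di.
exists (nth x (x :: s)), i; split.
- move=> u v; rewrite !inE mul1n -ss => lu lv /eqP.
  by rewrite nth_uniq // => /eqP.
- by move=> v; rewrite mul1n -ss => lv; apply/sA/mem_nth.
- move=> j; rewrite -ss => lj; move/(pathP x): ps => /(_ j lj) /= /andP[_ /eqP <-].
  congr c; apply/setP=> y; rewrite !inE; apply/imsetP/orP.
    case=> -[[|[|//]] hq] _ ->; rewrite [nat_of_ord _]/= muln1 ?addn0 ?addn1.
      by left.
    by right.
  case=> /eqP->; first by exists ord0; rewrite // muln1 addn0.
  by exists ord_max; rewrite // muln1 addn1.
Qed.

(** * Raising the uniformity by one *)

Lemma distinct_representatives (T : finType) l (E : nat -> {set T}) : 0 < l ->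
    (forall j, j < l -> l <= #|E j|) ->
  exists b : nat -> T, {in gtn l &, injective b} /\ forall j, j < l -> b j \in E j.
Proof.
case: l => // l _ bigE.
have [x0 _] : exists x, x \in E 0.
  by apply/set0Pn; rewrite -card_gt0; apply: leq_trans (bigE 0 isT).
suff build m : m <= l.+1 -> exists s, [/\ uniq s, size s = m &
    forall j, j < m -> nth x0 s j \in E j].
  have [s [us ss sE]] := build l.+1 (leqnn _).
  exists (nth x0 s); split=> // u v; rewrite !inE -ss => lu lv /eqP.
  by rewrite nth_uniq // => /eqP.
elim: m => [_|m IHm lt_ml]; first by exists [::].
have [s [us ss sE]] := IHm (ltnW lt_ml).
(* Only [m < l] elements are taken so far, and [E m] has at least [l]. *)
have [y] : exists y, y \in E m :\: [set z in s].
  apply/set0Pn; rewrite -card_gt0 cardsD subn_gt0.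
  apply: leq_ltn_trans (subset_leq_card (subsetIr _ _)) _.
  by rewrite cardsE (card_uniqP us) ss; apply: leq_trans (bigE m _).
rewrite !inE => /andP[ys yE]; exists (rcons s y); split.
- by rewrite rcons_uniq ys.
- by rewrite size_rcons ss.
- move=> j lj; rewrite nth_rcons ss; move: lj; rewrite ltnS leq_eqVlt => /predU1P[->|jm].
    by rewrite ltnn eqxx.
  by rewrite jm; apply: sE.
Qed.

Lemma exists_subset_card (T : finType) n (A : {set T}) :
  n <= #|A| -> exists2 B : {set T}, B \subset A & #|B| = n.
Proof.
move=> leA; exists [set x in take n (enum A)].
  by apply/subsetP=> x; rewrite inE => /mem_take; rewrite mem_enum.
rewrite cardsE (card_uniqP (take_uniq n (enum_uniq A))).
by rewrite size_takel // -cardE.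
Qed.

Lemma majority_color (T : finType) l r (g : T -> 'I_r) (B : {set T}) :
  0 < l -> 0 < #|B| -> l * r <= #|B| -> exists i, l <= #|[set b in B | g b == i]|.
Proof.
move=> l_gt0 B_gt0 leB; apply/existsP; apply: contraTT leB.
rewrite negb_exists -ltnNge => /forallP small.
have -> : #|B| = \sum_i #|[set b in B | g b == i]|.
  rewrite -sum1_card (partition_big g predT) //=.
  by apply: eq_bigr => i _; rewrite sum1dep_card.
(* The bound [r * l.-1 < l * r] below fails for [r = 0]. *)
have r_gt0 : 0 < r.
  by case/card_gt0P: B_gt0 => b _; apply: leq_ltn_trans (ltn_ord (g b)).
apply: (@leq_trans (\sum_(i < r) l.-1).+1); last first.
  rewrite sum_nat_const card_ord mulnC; nia.
rewrite ltnS; apply: leq_sum => i _.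
by have := small i; rewrite -ltnNge; lia.
Qed.

(** The path hypothesis ranges over all colourings because it is applied to the majority colouring
    derived from [c], not to [c] itself. *)
Lemma mono_path_step (T : finType) K l r (A B : {set T}) : 0 < K -> 0 < l ->
    [disjoint A & B] -> l * r <= #|B| -> 0 < #|B| ->
    (forall c : {set T} -> 'I_r, mono_loose_path c A K l) ->
  forall c : {set T} -> 'I_r, mono_loose_path c (A :|: B) K.+1 l.
Proof.
move=> K_gt0 l_gt0 dAB leB B_gt0 IH c.
pose ext (e : {set T}) i := [set b in B | c (b |: e) == i].
have majE e : exists i, l <= #|ext e i|.
  exact: (@majority_color T l r (fun b => c (b |: e))).
have [f [col [finj fA fc]]] := IH (fun e => xchoose (majE e)).
pose edge j := [set f (j * K + q) | q : 'I_K.+1].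
have [b [binj bE]] : exists b : nat -> T, {in gtn l &, injective b} /\
    forall j, j < l -> b j \in ext (edge j) col.
  apply: distinct_representatives => // j lj; rewrite -(fc j lj).
  exact: (xchooseP (majE (edge j))).
have bB j : j < l -> b j \in B by move/bE; rewrite inE => /andP[].
(* Vertex number [j * K.+1 + q] of the new path is the representative [b j] if
   [q = K], and vertex number [j * K + q] of the old path if [q < K]. *)
pose h v := if v %% K.+1 == K then b (v %/ K.+1)
            else f (v %/ K.+1 * K + v %% K.+1).
(* The final vertex [K.+1 * l] has quotient [l] and remainder [0], so it is the final old vertex
   [K * l]. *)
have old v : v <= K.+1 * l -> v %% K.+1 != K ->
    v %/ K.+1 * K + v %% K.+1 <= K * l.
  move=> lv nK; have := ltn_pmod v (ltn0Sn K); have := divn_eq v K.+1.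
  move: (v %/ _) (v %% _) nK => a q nK; nia.
have new v : v <= K.+1 * l -> v %% K.+1 == K -> v %/ K.+1 < l.
  move=> lv /eqP vK; have := divn_eq v K.+1; rewrite vK.
  move: (v %/ _) => a; nia.
have sep u v : u <= K * l -> v < l -> f u <> b v.
  move=> lu lv fb; move/pred0P/(_ (f u)): dAB => /=.
  by rewrite fA // fb bB.
exists h, col; split.
- move=> u v; rewrite !inE !ltnS /h => lu lv.
  have := old u lu; have := old v lv; have := new u lu; have := new v lv.
  have := ltn_pmod u (ltn0Sn K); have := ltn_pmod v (ltn0Sn K).
  rewrite 2!ltnS => vK uK nv nu ov ou huv.
  suff [Ea Eq] : u %/ K.+1 = v %/ K.+1 /\ u %% K.+1 = v %% K.+1.
    by rewrite (divn_eq u K.+1) (divn_eq v K.+1) Ea Eq.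
  move: (u %/ _) (u %% _) (v %/ _) (v %% _) vK uK nv nu ov ou huv.
  (* Two representatives: [b] is injective. One of each kind: [A] and [B] are disjoint. Two old
     vertices: division by [K] recovers block and offset, as both offsets are below [K]. *)
  move=> a q a' q'; case: eqP => [->|/eqP q'K]; case: eqP => [->|/eqP qK].
  + by move=> _ _ nv nu _ _ /binj-> //; [apply: nu|apply: nv].
  + by move=> _ _ nv _ _ ou E; case: (sep _ _ (ou isT) (nv isT)).
  + by move=> _ _ _ nu ov _ E; case: (sep _ _ (ov isT) (nu isT) (esym E)).
  + move=> leq' leq _ _ ov ou /finj; rewrite !inE !ltnS => /(_ (ou isT) (ov isT)).
    have ltq : q < K by rewrite ltn_neqAle qK.
    have ltq' : q' < K by rewrite ltn_neqAle q'K.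
    move=> E; have := congr1 (divn^~ K) E; have := congr1 (modn^~ K) E.
    by rewrite !modnMDl !divnMDl // !divn_small // !modn_small // !addn0.
- move=> v lv; rewrite /h inE; case: ifP => vK.
    by rewrite (bB _ (new v lv vK)) orbT.
  by rewrite fA // old // vK.
- move=> j lj; have := bE j lj; rewrite inE => /andP[_ /eqP <-]; congr c.
  apply/setP=> y; rewrite !inE; apply/imsetP/orP.
    case=> -[q hq] _ -> /=; rewrite /h.
    (* Offset [K.+1] is the first vertex of the next block, that is, old vertex [j * K + K], the
       last one of the old edge. *)
    case: (ltngtP q K) => qK.
    + right; rewrite divnMDl // modnMDl divn_small ?modn_small ?addn0; try lia.
      rewrite (ltn_eqF qK).
      by apply/imsetP; exists (inord q) => //; rewrite inordK //; lia.
    + have -> : q = K.+1 by lia.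
      right; rewrite -mulSnr modnMl mulnK // addn0.
      rewrite (ltn_eqF K_gt0).
      by apply/imsetP; exists ord_max => //=; rewrite mulSnr.
    + left; rewrite qK divnMDl // modnMDl divn_small ?modn_small ?addn0; try lia.
      by rewrite eqxx.
  case.
    move/eqP->; exists (inord K) => //; rewrite inordK /h; last by lia.
    by rewrite divnMDl // modnMDl divn_small ?modn_small ?addn0 ?eqxx; try lia.
  case/imsetP=> -[q hq] _ -> /=; case: (ltngtP q K) => qK; last 2 first.
  + lia.
  + exists ord_max => //=; rewrite /h -mulSnr modnMl mulnK // addn0.
    by rewrite (ltn_eqF K_gt0) qK mulSnr.
  + exists (inord q) => //; rewrite inordK /h; last by lia.
    rewrite divnMDl // modnMDl divn_small ?modn_small ?addn0; try lia.
    by rewrite (ltn_eqF qK).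
Qed.

Lemma mono_path_exists (T : finType) K l r (c : {set T} -> 'I_r) (A : {set T}) :
  0 < K -> 0 < l -> 1 < r -> K * l * r <= #|A| -> mono_loose_path c A K l.
Proof.
move=> K_gt0 l_gt0 r_gt1; elim: K K_gt0 A c => // -[_ _|K IHK _] A c leA.
  by apply: mono_path_graph; rewrite // -[l]mul1n.
have [B sBA cB] : exists2 B : {set T}, B \subset A & #|B| = l * r.
  by apply: exists_subset_card; apply: leq_trans leA; rewrite -mulnA leq_pmull.
have cA := cardsID B A; rewrite (setIidPr sBA) in cA.
rewrite -(setID A B) (setIidPr sBA) setUC.
apply: mono_path_step; rewrite ?cB //; first last.
- by move=> c'; apply: IHK => //; move: leA; rewrite -cA cB; nia.
- by nia.
- by apply/pred0P=> x; rewrite /= inE andbAC andNb.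
Qed.

(** * Translation to loose paths on ordinals and to Ramsey numbers *)

Lemma ramsey_prop_loose_path k l r : 2 <= k -> 0 < l -> 2 <= r ->
  ramsey_prop (loose_path k l) r ((k - 1) * l * r).
Proof.
move=> hk hl hr c.
have [||f [col [finj _ fc]]] := @mono_path_exists _ (k - 1) l r c setT _ hl hr.
- by lia.
- by rewrite cardsT card_ord.
exists (fun v : 'I_((k - 1) * l + 1) => f v), col; split=> [u v fuv|e /imsetP[j _ ->]].
  by apply/val_inj/finj => //; rewrite inE -[X in _ < X]addn1 ltn_ord.
rewrite -(fc j (ltn_ord j)); congr c; apply/setP=> y; apply/imsetP/imsetP.
  case=> v; rewrite inE => /andP[jv vj] ->.
  exists (inord (v - j * (k - 1))) => //; rewrite inordK; last by lia.
  by rewrite subnKC.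
case=> q _ ->.
have lt_q : j * (k - 1) + q < (k - 1) * l + 1.
  by have := ltn_ord q; have := ltn_ord j; nia.
exists (Ordinal lt_q) => //; rewrite inE /= leq_addr leq_add2l.
by have := ltn_ord q.
Qed.

(** The least number exists by descent from [n]; excluded middle decides whether a smaller one has
    the property. *)
Lemma ramsey_number_le (V : finType) (E : {set {set V}}) r n :
  ramsey_prop E r n -> exists R, is_ramsey_number E r R /\ R <= n.
Proof.
elim/ltn_ind: n => n IHn rn.
case: (classic (exists2 m, m < n & ramsey_prop E r m)) => [[m lt_mn rm]|min_n].
  have [R [isR leR]] := IHn m lt_mn rm.
  by exists R; split=> //; apply: leq_trans leR (ltnW lt_mn).
exists n; split=> //; split=> // m rm; rewrite leqNgt.
by apply/negP=> lt_mn; apply: min_n; exists m.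
Qed.

Theorem theorem1 (k l r : nat) (hk : 2 <= k) (hl : 3 <= l) (hr : 2 <= r) :
  exists R, is_ramsey_number (loose_path k l) r R /\ R <= (k - 1) * l * r.
Proof.
apply: ramsey_number_le; apply: ramsey_prop_loose_path => //.
by apply: leq_trans hl.
Qed.
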